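(* Let $A,B$ be real $n\times n$ diagonal matrices, let $k\in\{1,\dots,n\}$, let $\alpha_i^{(k)}\in\mathbb{R}$ for $i\in\{1,2,\dots,\lfloor k/2\rfloor\}$, and let $$\tilde A := A+\sum_{i=1}^{\lfloor k/2\rfloor}\alpha_i^{(k)}\left(E_{i(k-i+1)}+E_{i(k-i+1)}^\top\right),$$ where $E_{ij}$ is the $n\times n$ matrix with all entries zero except for the $(i,j)$ entry, which equals $1$. Then the interlacing property (as well as the weak interlacing property) holds for the pair $\tilde A,B$.
   Context: All matrices are real and $\otimes$ is the Kronecker product. Let $T\in\mathbb{R}^{n^2\times n^2}$ be the commutation matrix, i.e. $T\operatorname{vec}(X)=\operatorname{vec}(X^\top)$ for all $X\in\mathbb{R}^{n\times n}$, where $\operatorname{vec}$ stacks columns. A vector $x\in\mathbb{R}^{n^2}$ is symmetric if $Tx=x$ and skew-symmetric if $Tx=-x$. For symmetric $n\times n$ matrices $A,B$, $C:=A\otimes B+B\otimes A$ is a symmetric matrix commuting with $T$. The even eigenvalues of $C$ are its eigenvalues (with multiplicity) on the subspace of symmetric vectors, $\lambda_1\ge\cdots\ge\lambda_s$, $s=n(n+1)/2$; the odd eigenvalues are its eigenvalues (with multiplicity) on the subspace of skew-symmetric vectors, $\beta_1\ge\cdots\ge\beta_t$, $t=n(n-1)/2$. Interlacing property for $A,B$: $\lambda_i\ge\beta_i\ge\lambda_{s-t+i}$ for all $i\in\{1,\dots,t\}$. Weak interlacing property for $A,B$: $\min_{Tu=u}\frac{u^\top(A\otimes B)u}{u^\top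 u}\le\min_{Tw=-w}\frac{w^\top(A\otimes B)w}{w^\top w}$ and $\max_{Tw=-w}\frac{w^\top(A\otimes B)w}{w^\top w}\le\max_{Tu=u}\frac{u^\top(A\otimes B)u}{u^\top u}$, over nonzero vectors. *)

(* Defs.v *)
From HB Require Import structures.
From mathcomp Require Import all_boot all_order all_algebra.
From mathcomp Require Import mxtens.
From mathcomp Require Import classical_sets reals.

Set Implicit Arguments.
Unset Strict Implicit.
Unset Printing Implicit Defensive.

Import Order.TTheory GRing.Theory Num.Theory.
Local Open Scope classical_set_scope.
Local Open Scope ring_scope.

(* [tensmx A B] is the Kronecker product; its rows and columns are indexed by
   [mxtens_index (i, j)], of value [i * n + j]. *)

(* Column stacking: entry [j * n + i] of [vecmx X] is [X i j]. *)
Definition vecmx (R : realType) (n : nat) (X : 'M[R]_n) : 'cV[R]_(n * n) :=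
  \col_k X (mxtens_unindex k).2 (mxtens_unindex k).1.

Definition commutation_mx (R : realType) (n : nat) : 'M[R]_(n * n) :=
  \matrix_(k, l) (((mxtens_unindex k).1 == (mxtens_unindex l).2) &&
                  ((mxtens_unindex k).2 == (mxtens_unindex l).1))%:R.

Lemma commutation_mx_vec (R : realType) (n : nat) (X : 'M[R]_n) :
  commutation_mx R n *m vecmx X = vecmx X^T.
Proof.
apply/colP => k; case: (mxtens_indexP k) => i j; rewrite !mxE mxtens_indexK.
rewrite (bigD1 (mxtens_index (j, i))) //= big1 ?addr0 => [|l].
  by rewrite !mxE !mxtens_indexK /= !eqxx mul1r.
case: (mxtens_indexP l) => p q ne; rewrite !mxE !mxtens_indexK /=.
case: andP => [[/eqP eq_i /eqP eq_j]|_]; last by rewrite mul0r.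
by move: ne; rewrite eq_i eq_j eqxx.
Qed.

Lemma commutation_mx_uniq (R : realType) (n : nat) (T : 'M[R]_(n * n)) :
  (forall X : 'M[R]_n, T *m vecmx X = vecmx X^T) -> T = commutation_mx R n.
Proof.
move=> hT; apply/matrixP => k l.
case: (mxtens_indexP l) => i j.
have vX : vecmx (delta_mx j i) = delta_mx (mxtens_index (i, j)) 0 :> 'cV[R]_(n * n).
  apply/colP => m; case: (mxtens_indexP m) => p q.
  rewrite !mxE mxtens_indexK eqxx andbT (can_eq (@mxtens_indexK n n)).
  by rewrite xpair_eqE andbC.
have := hT (delta_mx j i); rewrite -commutation_mx_vec vX -!colE => /colP/(_ k).
by rewrite !mxE.
Qed.

(* [eigenspace] acts on rows, so the rows of [eigenspace M^T a] span the
   transposes of the column vectors [u] such that [M *m u = a *: u]. *)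
Definition symmetric_space (R : realType) (n : nat) : 'M[R]_(n * n) :=
  eigenspace (commutation_mx R n)^T 1.

Definition skew_space (R : realType) (n : nat) : 'M[R]_(n * n) :=
  eigenspace (commutation_mx R n)^T (- 1).

Lemma symmetric_spaceP (R : realType) (n : nat) (u : 'cV[R]_(n * n)) :
  (u^T <= symmetric_space R n)%MS <-> commutation_mx R n *m u = u.
Proof.
split=> [/eigenspaceP|h]; last by apply/eigenspaceP; rewrite -trmx_mul h scale1r.
by rewrite -trmx_mul scale1r => /trmx_inj.
Qed.

Lemma skew_spaceP (R : realType) (n : nat) (w : 'cV[R]_(n * n)) :
  (w^T <= skew_space R n)%MS <-> commutation_mx R n *m w = - w.
Proof.
split=> [/eigenspaceP|h].
  by rewrite -trmx_mul scaleN1r -linearN => /trmx_inj.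
by apply/eigenspaceP; rewrite -trmx_mul h scaleN1r linearN.
Qed.

(* [l] lists, in nonincreasing order and with multiplicity, the eigenvalues of
   [C] having eigenvectors in [W]; for [C] symmetric and leaving [W] invariant,
   such a list has length [\rank W]. *)
Definition eigenvalues_on (R : realType) (m : nat) (C W : 'M[R]_m) (l : seq R) :=
  sorted >=%R l /\
  forall mu : R, count_mem mu l = \rank (eigenspace C^T mu :&: W)%MS.

Lemma eigenvalues_on_uniq (R : realType) (m : nat) (C W : 'M[R]_m)
    (l1 l2 : seq R) :
  eigenvalues_on C W l1 -> eigenvalues_on C W l2 -> l1 = l2.
Proof.
move=> [s1 c1] [s2 c2]; apply: (sorted_eq (leT := >=%R)) => //.
- exact: ge_trans.
- exact: ge_anti.
- by apply/allP => x _ /=; rewrite c1 c2.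
Qed.

(* The sequences are indexed from 0. *)
Definition interlacing (R : realType) (n : nat) (A B : 'M[R]_n) : Prop :=
  let C := tensmx A B + tensmx B A in
  let s := (n * (n + 1) %/ 2)%N in
  let t := (n * (n - 1) %/ 2)%N in
  exists (lambda : s.-tuple R) (beta : t.-tuple R),
    [/\ eigenvalues_on C (symmetric_space R n) lambda,
        eigenvalues_on C (skew_space R n) beta
      & forall i : nat, (i < t)%N ->
          lambda`_(s - t + i)%N <= beta`_i <= lambda`_i].

Definition rayleigh (R : realType) (m : nat) (M : 'M[R]_m) (u : 'cV[R]_m) : R :=
  (u^T *m M *m u) 0 0 / (u^T *m u) 0 0.

Definition symmetric_quotients (R : realType) (n : nat) (M : 'M[R]_(n * n)) :
    set R :=
  [set rayleigh M u | u in [set u | u != 0 /\ commutation_mx R n *m u = u]].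

Definition skew_quotients (R : realType) (n : nat) (M : 'M[R]_(n * n)) :
    set R :=
  [set rayleigh M w | w in [set w | w != 0 /\ commutation_mx R n *m w = - w]].

Definition is_min (R : realType) (S : set R) (m : R) := S m /\ lbound S m.
Definition is_max (R : realType) (S : set R) (m : R) := S m /\ ubound S m.

(* There is a nonzero skew-symmetric vector exactly when [1 < n]; otherwise the
   skew minimum and maximum are [+oo] and [-oo], and both inequalities are void. *)
Definition weak_interlacing (R : realType) (n : nat) (A B : 'M[R]_n) : Prop :=
  let Qsym := symmetric_quotients (tensmx A B) in
  let Qskew := skew_quotients (tensmx A B) in
  Qskew !=set0 ->
  (exists min_sym min_skew : R,
     [/\ is_min Qsym min_sym, is_min Qskew min_skew & min_sym <= min_skew]) /\
  (exists max_skew max_sym : R,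
     [/\ is_max Qskew max_skew, is_max Qsym max_sym & max_skew <= max_sym]).

(* The matrix unit $E_{ij}$, with rows and columns numbered from 1. *)
Definition elem_mx (R : realType) (n i j : nat) : 'M[R]_n :=
  \matrix_(p, q) ((p.+1 == i) && (q.+1 == j))%:R.

(* Main.v *)
(* In the index order 1, k, 2, k - 1, ... the matrix [At] is tridiagonal.  Multiply
   the (i, j) entry of a skew-symmetric vector by the sign of the comparison of i
   and j in this order: the result is symmetric, with the same norm.  Since [B] is
   diagonal and [At] tridiagonal, a nonzero entry of [At (x) B] or [B (x) At] never
   joins positions strictly on opposite sides of the diagonal, and the diagonal
   entries of a skew-symmetric vector vanish, so the quadratic forms are preserved
   too.  The restriction of [C] to the skew-symmetric vectors is thus isometric to
   a compression of its restriction to the symmetric ones, and Cauchy's interlacing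
   theorem applies; likewise every skew Rayleigh quotient is a symmetric one. *)

Require Import Defs.
From mathcomp Require Import all_boot all_order all_fingroup all_algebra.
From mathcomp Require Import complex mxtens classical_sets reals.
From mathcomp Require Import zify ring lra.

Set Implicit Arguments.
Unset Strict Implicit.
Unset Printing Implicit Defensive.

Import Order.TTheory GRing.Theory Num.Theory.
Local Open Scope ring_scope.

(** * Squared norms of real row vectors *)

Section NormSquared.
Variables (R : realFieldType) (m : nat).
Implicit Types x : 'rV[R]_m.

Lemma mulmx_trE x (y : 'rV[R]_m) : (x *m y^T) 0 0 = \sum_i x 0 i * y 0 i.
Proof. by rewrite mxE; apply: eq_bigr => i _; rewrite mxE. Qed.

Lemma mulmx_tr_sqr x : (x *m x^T) 0 0 = \sum_i x 0 i ^+ 2.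
Proof. by rewrite mulmx_trE. Qed.

Lemma mulmx_tr_ge0 x : 0 <= (x *m x^T) 0 0.
Proof. by rewrite mulmx_tr_sqr sumr_ge0 // => i _; rewrite sqr_ge0. Qed.

Lemma mulmx_tr_eq0 x : ((x *m x^T) 0 0 == 0) = (x == 0).
Proof.
apply/eqP/eqP => [|->]; last by rewrite mul0mx mxE.
rewrite mulmx_tr_sqr => /psumr_eq0P sum0; apply/rowP => i; rewrite mxE.
by apply/eqP; rewrite -sqrf_eq0 sum0 // => j _; rewrite sqr_ge0.
Qed.

Lemma mulmx_tr_gt0 x : (0 < (x *m x^T) 0 0) = (x != 0).
Proof. by rewrite lt_def mulmx_tr_ge0 mulmx_tr_eq0 andbT. Qed.

Lemma mulmx_trC x (y : 'rV[R]_m) : x *m y^T = y *m x^T.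
Proof. by rewrite -[LHS]trmxK trmx_mul trmxK [LHS]mx11_scalar mxE -mx11_scalar. Qed.

End NormSquared.

(** * Real eigenvectors of a symmetric matrix inside an invariant subspace *)

Section RealSpectral.
Variable R : rcfType.

Lemma Re_mulmx_real p q r (y : 'M[R[i]]_(p, q)) (C : 'M[R]_(q, r)) :
  map_mx (@complex.Re R) (y *m map_mx (real_complex R) C) =
  map_mx (@complex.Re R) y *m C.
Proof.
apply/matrixP => i j; rewrite !mxE raddf_sum; apply: eq_bigr => l _.
by rewrite !mxE; case: (y i l) => a b /=; rewrite mulr0 subr0.
Qed.

Lemma Im_mulmx_real p q r (y : 'M[R[i]]_(p, q)) (C : 'M[R]_(q, r)) :
  map_mx (@complex.Im R) (y *m map_mx (real_complex R) C) =
  map_mx (@complex.Im R) y *m C.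
Proof.
apply/matrixP => i j; rewrite !mxE raddf_sum; apply: eq_bigr => l _.
by rewrite !mxE; case: (y i l) => a b /=; rewrite mulr0 add0r.
Qed.

(** The restriction of [C] to [W] has a complex eigenvector. Symmetry makes its eigenvalue real, so
    its real or its imaginary part, whichever is nonzero, serves as [v]. *)
Lemma symmetric_eigenvector m (C W : 'M[R]_m) :
    C^T = C -> stablemx W C -> W != 0 ->
  exists a, exists2 v : 'rV[R]_m, v != 0 & (v <= W)%MS /\ v *m C = a *: v.
Proof.
move=> symC stabW nzW; set M := row_base W.
have rW : (0 < \rank W)%N by rewrite lt0n mxrank_eq0.
have stabM : (M *m C <= M)%MS.
  have := stablemx_row_base W C; by rewrite /M => ->.
(* [S] is the matrix of the restriction of [C] to [W] in the basis [M]. *)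
have [S defS] := submxP stabM.
have [mu /eigenvalueP[x xS nzx]] := eigenvalue_closed (map_mx (real_complex R) S) rW.
set y := x *m map_mx (real_complex R) M.
have nzy : y != 0.
  apply: contra nzx => /eqP y0; apply/eqP.
  have free : row_free (map_mx (real_complex R) M).
    by rewrite /row_free mxrank_map; exact: row_base_free.
  by apply: (row_free_inj free); rewrite mul0mx.
have yC : y *m map_mx (real_complex R) C = mu *: y.
  by rewrite -mulmxA -map_mxM defS map_mxM mulmxA xS -scalemxAl.
set p := map_mx (@complex.Re R) y; set q := map_mx (@complex.Im R) y.
have pW : (p <= W)%MS.
  by rewrite /p /y Re_mulmx_real (submx_trans (submxMl _ _)) // /M eq_row_base.
have qW : (q <= W)%MS.
  by rewrite /q /y Im_mulmx_real (submx_trans (submxMl _ _)) // /M eq_row_base.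
move: @p @q pW qW; clearbody y => p q pW qW.
case: mu yC {xS} => a b yC.
have pC : p *m C = a *: p - b *: q.
  rewrite -Re_mulmx_real yC; apply/rowP => i; rewrite !mxE.
  by case: (y 0 i).
have qC : q *m C = b *: p + a *: q.
  rewrite -Im_mulmx_real yC; apply/rowP => i; rewrite !mxE addrC.
  by case: (y 0 i).
have nzpq : (p != 0) || (q != 0).
  apply: contraR nzy; rewrite negb_or !negbK => /andP[/eqP p0 /eqP q0].
  apply/eqP/rowP => i; move/rowP: p0 => /(_ i); move/rowP: q0 => /(_ i).
  by rewrite !mxE; case: (y 0 i) => c d /= -> ->.
have sumgt0 : 0 < (p *m p^T) 0 0 + (q *m q^T) 0 0.
  case/orP: nzpq => nz.
    by rewrite ltr_pwDl ?mulmx_tr_gt0 ?mulmx_tr_ge0.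
  by rewrite ltr_wpDl ?mulmx_tr_gt0 ?mulmx_tr_ge0.
(* Expanding both sides of p C q^T = q C p^T leaves b (|p|^2 + |q|^2) = 0. *)
have b0 : b = 0.
  have : p *m C *m q^T = q *m C *m p^T.
    by rewrite -mulmxA -[C in LHS]symC -trmx_mul mulmx_trC.
  rewrite pC qC mulmxBl mulmxDl -!scalemxAl (mulmx_trC q p).
  move=> /matrixP/(_ 0 0); rewrite !mxE.
  set P := \sum_j _; set Q := \sum_j _; set X := \sum_j _.
  move=> E; have : b * ((p *m p^T) 0 0 + (q *m q^T) 0 0) = 0.
    rewrite !mxE -/Q -/X; lra.
  by move/eqP; rewrite mulf_eq0 (gt_eqF sumgt0) orbF => /eqP.
exists a; move: pC qC; rewrite b0 !scale0r subr0 add0r => pC qC.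
by case/orP: nzpq => nz; [exists p | exists q].
Qed.
End RealSpectral.

(** * Orthonormal diagonalization on an invariant subspace *)

Section Orthonormal.
Variable R : rcfType.

Lemma orthonormal_row_free r m (U : 'M[R]_(r, m)) : U *m U^T = 1%:M -> row_free U.
Proof. by move=> UU; apply/row_freeP; exists U^T. Qed.

(** Induction on the dimension: split off a unit eigenvector [u]. Its orthogonal complement in [W]
    is again stable because [C] is symmetric. *)
Lemma symmetric_diagonalization r m (C W : 'M[R]_m) :
    C^T = C -> stablemx W C -> \rank W = r ->
  exists (U : 'M[R]_(r, m)) (d : 'rV[R]_r),
    [/\ U *m U^T = 1%:M, (U <= W)%MS & U *m C = diag_mx d *m U].
Proof.
move=> symC; elim: r W => [|r IHr] W stabW rankW.
  by exists 0, 0; split; rewrite ?sub0mx //; apply/matrixP; case.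
have nzW : W != 0 by rewrite -mxrank_eq0 rankW.
have [a [v nzv [vW vC]]] := symmetric_eigenvector symC stabW nzW.
set c := Num.sqrt ((v *m v^T) 0 0); pose u := c^-1 *: v.
have c_gt0 : 0 < c by rewrite sqrtr_gt0 mulmx_tr_gt0.
have uu : u *m u^T = 1%:M.
  rewrite linearZ /= -scalemxAr -scalemxAl scalerA [v *m _]mx11_scalar.
  rewrite -[(v *m v^T) 0 0]sqr_sqrtr ?mulmx_tr_ge0 // -/c scale_scalar_mx.
  by congr _%:M; field; rewrite gt_eqF.
have uC : u *m C = a *: u by rewrite -scalemxAl vC !scalerA mulrC.
have uW : (u <= W)%MS by rewrite scalemx_sub.
clearbody u; pose W' := (W :&: kermx u^T)%MS.
have stabW' : stablemx W' C.
  rewrite sub_capmx (submx_trans _ stabW) ?submxMr ?capmxSl //=.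
  apply/sub_kermxP; rewrite -mulmxA -[C]symC -trmx_mul uC linearZ /= -scalemxAr.
  by rewrite (sub_kermxP (capmxSr _ _)) scaler0.
(* [W *m u^T] is a single column, nonzero since [u] lies in [W] and has norm 1; so passing to its
   kernel costs exactly one dimension. *)
have rankW' : \rank W' = r.
  have := mxrank_mul_ker W u^T; rewrite rankW -/W'.
  suff -> : \rank (W *m u^T) = 1%N by rewrite add1n => -[].
  apply/eqP; rewrite eqn_leq rank_leq_col lt0n mxrank_eq0.
  have [z uz] := submxP uW; apply/eqP => Wu.
  move: uu; rewrite {1}uz -mulmxA Wu mulmx0 => /matrixP/(_ 0 0).
  by rewrite !mxE => /eqP; rewrite eq_sym oner_eq0.
have [U [d [UU UW UC]]] := IHr _ stabW' rankW'.
have Uu : U *m u^T = 0 by apply/sub_kermxP/(submx_trans UW)/capmxSr.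
(* Writing the size as [1 + r] lets the block operations [col_mx] and [row_mx] apply. *)
suff: exists (U : 'M[R]_(1 + r, m)) (d : 'rV[R]_(1 + r)),
    [/\ U *m U^T = 1%:M, (U <= W)%MS & U *m C = diag_mx d *m U] by [].
exists (col_mx u U), (row_mx a%:M d); split.
- rewrite tr_col_mx mul_col_row uu UU Uu -[u *m U^T]trmxK trmx_mul trmxK Uu trmx0.
  by rewrite -scalar_mx_block.
- by rewrite col_mx_sub uW (submx_trans UW) ?capmxSl.
- rewrite mul_col_mx uC UC diag_mx_row mul_block_col !mul0mx addr0 add0r.
  congr (col_mx _ _); rewrite (_ : diag_mx _ = a%:M) ?mul_scalar_mx //.
  by apply/matrixP => i j; rewrite !ord1 !mxE !eqxx.
Qed.

Lemma orthonormal_span r m (U : 'M[R]_(r, m)) (W : 'M[R]_m) :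
  U *m U^T = 1%:M -> (U <= W)%MS -> \rank W = r -> (U :=: W)%MS.
Proof.
move=> /orthonormal_row_free; rewrite /row_free => /eqP rankU UW rankW.
by apply/eqmxP; rewrite UW /= -(mxrank_leqif_sup UW) rankU rankW.
Qed.

Lemma sorted_diagonalization (r m : nat) (C W : 'M[R]_m) :
    C^T = C -> stablemx W C -> \rank W = r ->
  exists (U : 'M[R]_(r, m)) (l : r.-tuple R),
    [/\ U *m U^T = 1%:M, (U :=: W)%MS, sorted >=%R l
      & U *m C = diag_mx (\row_i l`_i) *m U].
Proof.
move=> symC stabW rankW.
have [U [d [UU UW UC]]] := symmetric_diagonalization symC stabW rankW.
pose l := sort_tuple >=%R [tuple d 0 i | i < r].
(* The permutation [p] that sorts the eigenvalues is also applied to the rows of [U], which keeps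
   the eigenpairs together. *)
have /tuple_permP[p lE] : perm_eq l [tuple d 0 i | i < r] by rewrite /= perm_sort.
have lp (i : 'I_r) : l`_i = d 0 (p i) by rewrite lE -tnth_nth !tnth_mktuple.
have UUp : row_perm p U *m (row_perm p U)^T = 1%:M.
  apply/matrixP => i j; have /matrixP/(_ (p i) (p j)) := UU.
  rewrite !mxE (inj_eq perm_inj) => <-; apply: eq_bigr => k _.
  by rewrite !mxE.
exists (row_perm p U), l; split => //.
- by apply: orthonormal_span => //; rewrite row_permE (submx_trans (submxMl _ _)).
- by apply: sort_sorted => x y; exact: le_total.
- apply/row_matrixP => i; have := congr1 (row (p i)) UC.
  rewrite !row_mul !row_diag_mx -!scalemxAl -!rowE mxE lp => UCi.
  suff -> : row i (row_perm p U) = row (p i) U by [].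
  by apply/rowP => k; rewrite !mxE.
Qed.
End Orthonormal.

(** * Eigenvalue multiplicities and Cauchy interlacing for compressions *)

Section Interlacing.
Variable R : rcfType.

Lemma quadratic_diag m (d x : 'rV[R]_m) :
  (x *m diag_mx d *m x^T) 0 0 = \sum_i d 0 i * x 0 i ^+ 2.
Proof.
by rewrite mul_mx_diag mulmx_trE; apply: eq_bigr => i _; rewrite !mxE; ring.
Qed.

(** In the orthonormal basis [U] the matrix is diagonal, so the [mu]-eigenvectors in [W] are spanned
    by the rows of [U] whose eigenvalue is [mu]. This links the sorted lists to [eigenvalues_on]. *)
Lemma rank_eigenspace_cap (r m : nat) (C W : 'M[R]_m) (U : 'M[R]_(r, m))
    (l : r.-tuple R) mu :
    U *m U^T = 1%:M -> (U :=: W)%MS -> U *m C = diag_mx (\row_i l`_i) *m U ->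
  \rank (eigenspace C mu :&: W)%MS = count_mem mu l.
Proof.
move=> UU UW UC; pose J := [set i : 'I_r | l`_i == mu].
pose K : 'M[R]_(#|J|, m) := rowsub enum_val U.
have rowUC i : row i U *m C = l`_i *: row i U.
  by rewrite -row_mul UC row_mul row_diag_mx -scalemxAl -rowE !mxE.
have Kfree : row_free K.
  apply: orthonormal_row_free; apply/matrixP => i j.
  have /matrixP/(_ (enum_val i) (enum_val j)) := UU.
  rewrite !mxE (inj_eq enum_val_inj) => <-; apply: eq_bigr => k _.
  by rewrite !mxE.
suff /eqmx_rank -> : (eigenspace C mu :&: W == K)%MS.
  rewrite (eqP Kfree) cardE /enum_mem size_filter.
  rewrite -[X in count_mem _ X](@map_tnth_enum _ _ l) [RHS]count_map enumT.
  by apply: eq_count => i; rewrite /= inE (tnth_nth 0).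
apply/andP; split.
  apply/rV_subP => x; rewrite sub_capmx -UW => /andP[/eigenspaceP xC].
  case/submxP => z xz; move: xC; rewrite xz -mulmxA UC mulmxA scalemxAl.
  move/(row_free_inj (orthonormal_row_free UU))/rowP => zl.
  rewrite mulmx_sum_row summx_sub // => i _.
  have := zl i; rewrite mul_mx_diag !mxE => zi.
  have [->|nzi] := eqVneq (z 0 i) 0; first by rewrite scale0r sub0mx.
  have iJ : i \in J.
    by rewrite inE; apply/eqP/(mulfI nzi); rewrite zi mulrC.
  rewrite scalemx_sub // -(enum_rankK_in iJ iJ) -row_rowsub.
  exact: row_sub.
apply/row_subP => j; rewrite row_rowsub sub_capmx -UW row_sub andbT.
apply/eigenspaceP; rewrite rowUC.
by have := enum_valP j; rewrite inE => /eqP ->.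
Qed.

(** Dimension count: some nonzero [y] supported on [J] has an image [y *m Q] that vanishes on [L].
    This map preserves norms, so the common Rayleigh quotient is at least [b] by [bet] and at most
    [a] by [lam]. *)
Lemma compression_compare s t (Q : 'M[R]_(t, s)) (lam : 'rV[R]_s) (bet : 'rV[R]_t)
    (J : {set 'I_t}) (L : {set 'I_s}) a b :
    Q *m Q^T = 1%:M -> Q *m diag_mx lam *m Q^T = diag_mx bet -> (#|L| < #|J|)%N ->
    {in J, forall j, b <= bet 0 j} -> {in ~: L, forall l, lam 0 l <= a} ->
  b <= a.
Proof.
move=> QQ Qlam ltLJ betJ lamL.
pose N : 'M[R]_(#|J|, #|L|) := mxsub enum_val enum_val Q.
(* The block of [Q] with rows in [J] and columns in [L] has more rows than columns, hence a nonzero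
   left kernel vector; [y] below extends it by zero. *)
have /rowV0Pn[z /sub_kermxP zN nzz] : kermx N != 0.
  rewrite -mxrank_eq0 mxrank_ker subn_eq0 -ltnNge.
  exact: leq_ltn_trans (rank_leq_col _) ltLJ.
pose y := z *m rowsub enum_val (1%:M : 'M[R]_t).
have yE i : y 0 (enum_val i) = z 0 i.
  rewrite mxE (bigD1 i) //= !mxE eqxx mulr1 big1 ?addr0 // => j ne.
  by rewrite !mxE (inj_eq enum_val_inj) (negPf ne) mulr0.
have y0 j : j \notin J -> y 0 j = 0.
  move=> jJ; rewrite mxE big1 // => i _; rewrite !mxE.
  case: eqP => [E|]; last by rewrite mulr0.
  by move: jJ; rewrite -E enum_valP.
have yy : 0 < (y *m y^T) 0 0.
  rewrite mulmx_tr_gt0; apply: contra nzz => /eqP y00; apply/eqP/rowP => i.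
  by rewrite -yE y00 !mxE.
pose x := y *m Q.
have x0 l : l \in L -> x 0 l = 0.
  move=> lL; rewrite /x /y -mulmxA mul_rowsub_mx mul1mx.
  have /rowP/(_ (enum_rank_in lL l)) := zN; rewrite !mxE => zNl; rewrite -[RHS]zNl.
   by apply: eq_bigr => i _; rewrite !mxE enum_rankK_in.
have xx : (x *m x^T) 0 0 = (y *m y^T) 0 0.
  by rewrite /x trmx_mul mulmxA -(mulmxA y) QQ mulmx1.
have lo : b * (y *m y^T) 0 0 <= (y *m diag_mx bet *m y^T) 0 0.
  rewrite quadratic_diag mulmx_tr_sqr mulr_sumr ler_sum // => j _.
  have [jJ|jJ] := boolP (j \in J); first by rewrite ler_wpM2r ?sqr_ge0 ?betJ.
  by rewrite y0 // expr0n !mulr0.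
have hi : (x *m diag_mx lam *m x^T) 0 0 <= a * (x *m x^T) 0 0.
  rewrite quadratic_diag mulmx_tr_sqr mulr_sumr ler_sum // => l _.
  have [lL|lL] := boolP (l \in L); first by rewrite x0 // expr0n !mulr0.
  by rewrite ler_wpM2r ?sqr_ge0 // lamL // inE.
have E : x *m diag_mx lam *m x^T = y *m diag_mx bet *m y^T.
  by rewrite -Qlam /x trmx_mul !mulmxA.
by rewrite -(ler_pM2r yy) (le_trans lo) // -E -xx.
Qed.

Lemma card_ord_ltn (n i : nat) : (i <= n)%N -> #|[set j : 'I_n | (j < i)%N]| = i.
Proof.
move=> lein; rewrite -sum1dep_card -(big_ord_widen n (fun=> 1%N) lein).
by rewrite sum1_card card_ord.
Qed.

Lemma card_ord_geq (n i : nat) :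
  (i <= n)%N -> #|~: [set j : 'I_n | (j < i)%N]| = (n - i)%N.
Proof. by move=> lein; rewrite cardsCs finset.setCK card_ord card_ord_ltn. Qed.

Lemma sorted_ge_nth (s : seq R) i j :
  sorted >=%R s -> (i <= j < size s)%N -> s`_j <= s`_i.
Proof.
move=> sorts /andP[leij ltj].
by apply: (sorted_leq_nth ge_trans lexx) => //; rewrite inE // (leq_ltn_trans leij).
Qed.

Lemma cauchy_interlacing (s t : nat) (Q : 'M[R]_(t, s)) (lam : s.-tuple R)
    (bet : t.-tuple R) i :
    sorted >=%R lam -> sorted >=%R bet -> Q *m Q^T = 1%:M ->
    Q *m diag_mx (\row_j lam`_j) *m Q^T = diag_mx (\row_j bet`_j) ->
    (i < t)%N ->
  lam`_(s - t + i) <= bet`_i <= lam`_i.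
Proof.
move=> slam sbet QQ Qlam lti.
have lets : (t <= s)%N.
  by have := rank_leq_col Q; rewrite (eqP (orthonormal_row_free QQ)).
apply/andP; split; last first.
  (* The [i.+1] largest entries of [bet] against only [i] entries of [lam] to be avoided. *)
  apply: (@compression_compare s t Q (\row_j lam`_j) (\row_j bet`_j)
    [set j : 'I_t | (j < i.+1)%N] [set j : 'I_s | (j < i)%N]) => //.
  - by rewrite !card_ord_ltn; lia.
  - move=> j; rewrite inE => ltj; rewrite mxE; apply: sorted_ge_nth => //.
    by rewrite size_tuple; lia.
  - move=> j; rewrite !inE => ltj; rewrite mxE; apply: sorted_ge_nth => //.
    by rewrite size_tuple; have := ltn_ord j; lia.
(* The lower bound is the same comparison for the negated matrices, with final segments: [t - i]
   indices of [bet] against [t - i - 1] of [lam]. *)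
rewrite -lerN2.
apply: (@compression_compare s t Q (- \row_j lam`_j) (- \row_j bet`_j)
  (~: [set j : 'I_t | (j < i)%N]) (~: [set j : 'I_s | (j < s - t + i.+1)%N])) => //.
- by rewrite (raddfN (@diag_mx R s)) mulmxN mulNmx Qlam (raddfN (@diag_mx R t)).
- by rewrite !card_ord_geq; lia.
- move=> j; rewrite !inE => ltj; rewrite !mxE lerN2; apply: sorted_ge_nth => //.
  by rewrite size_tuple; have := ltn_ord j; lia.
- move=> j; rewrite !inE => ltj; rewrite !mxE lerN2; apply: sorted_ge_nth => //.
  by rewrite size_tuple; have := ltn_ord j; lia.
Qed.
End Interlacing.

(** [M] need not leave [W] invariant, as happens for [tensmx A B] on the symmetric or skew space.
    The symmetric [C] does, and has the same quadratic form there; its last and first eigenvalues on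
    [W] are the extrema. *)
Lemma rayleigh_extrema (R : realType) m (M C W : 'M[R]_m) (P : 'cV[R]_m -> Prop) :
    C^T = C -> stablemx W C -> W != 0 ->
    (forall x : 'rV_m, (x <= W)%MS -> x *m M *m x^T = x *m C *m x^T) ->
    (forall u, (u^T <= W)%MS <-> P u) ->
  let S := [set rayleigh M u | u in [set u | u != 0 /\ P u]]%classic in
  (exists a, is_min S a) /\ (exists b, is_max S b).
Proof.
move=> symC stabW nzW MC WP S; set r := \rank W.
have r_gt0 : (0 < r)%N by rewrite lt0n mxrank_eq0.
have [U [l [UU UW sl UC]]] := sorted_diagonalization symC stabW (erefl r).
have S_row i : S l`_(val (i : 'I_r)).
  exists (row i U)^T.
    split; last by apply/WP; rewrite trmxK -UW row_sub.
    apply/eqP => /(congr1 trmx); rewrite trmxK => Ui0.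
    have := congr1 (row i) UU; rewrite row_mul Ui0 trmx0 mul0mx => /rowP/(_ i).
    by rewrite !mxE eqxx => /eqP; rewrite eq_sym oner_eq0.
  rewrite /rayleigh !trmxK MC -?UW ?row_sub //.
  have -> : row i U *m C = l`_i *: row i U.
    by rewrite -row_mul UC row_mul row_diag_mx -scalemxAl -rowE !mxE.
  have E1 : (row i U *m (row i U)^T) 0 0 = 1.
    have /matrixP/(_ i i) := UU; rewrite !mxE eqxx; apply: etrans.
    by apply: eq_bigr => k _; rewrite !mxE.
  by rewrite -scalemxAl mxE E1 divr1 mulr1.
have S_bounds a : S a -> l`_r.-1 <= a <= l`_0.
  case=> u [nzu /WP]; move: nzu; rewrite -[u]trmxK trmx_eq0.
  move: (u^T) => {u} x; rewrite trmxK => nzx xW <-.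
  rewrite /rayleigh trmxK MC // ler_pdivlMr ?mulmx_tr_gt0 //.
  rewrite ler_pdivrMr ?mulmx_tr_gt0 //.
  (* In the coordinates [z] of the vector in the basis [U], the quotient is an average of the
     eigenvalues with weights the squares of the coordinates. *)
  move: xW {nzx}; rewrite -UW => /submxP[z ->].
  rewrite -(mulmxA z U C) UC trmx_mul !mulmxA -!(mulmxA _ U) UU !mulmx1.
  rewrite quadratic_diag mulmx_tr_sqr !mulr_sumr.
    apply/andP; split; apply: ler_sum => j _; rewrite ler_wpM2r ?sqr_ge0 // mxE;
    apply: sorted_ge_nth => //; rewrite size_tuple; have := ltn_ord j; lia.
split.
  exists l`_r.-1; split; first by apply: (S_row (Ordinal (_ : r.-1 < r)%N)); lia.
  by move=> a /S_bounds/andP[].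
exists l`_0; split; first exact: (S_row (Ordinal r_gt0)).
by move=> a /S_bounds/andP[].
Qed.

(** * The commutation matrix, its eigenspaces and their dimensions *)

Section Commutation.
Variables (R : realType) (n : nat).
Local Notation T := (commutation_mx R n).
Local Notation ti := (@mxtens_index n n).
Implicit Types A B : 'M[R]_n.

Lemma mul_commutation_mx q (M : 'M[R]_(n * n, q)) i j l :
  (T *m M) (ti (i, j)) l = M (ti (j, i)) l.
Proof.
rewrite mxE (bigD1 (ti (j, i))) //= big1 ?addr0 => [|k].
  by rewrite !mxE !mxtens_indexK /= !eqxx mul1r.
case: (mxtens_indexP k) => a b ne; rewrite !mxE !mxtens_indexK /=.
case: andP => [[/eqP eq_i /eqP eq_j]|_]; last by rewrite mul0r.
by move: ne; rewrite eq_i eq_j eqxx.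
Qed.

Lemma trmx_commutation : T^T = T.
Proof.
apply/matrixP => k l; rewrite !mxE andbC.
by rewrite (eq_sym (mxtens_unindex l).1) (eq_sym (mxtens_unindex l).2).
Qed.

Lemma mul_mx_commutation p (M : 'M[R]_(p, n * n)) k i j :
  (M *m T) k (ti (i, j)) = M k (ti (j, i)).
Proof.
by rewrite -[M *m T]trmxK trmx_mul trmx_commutation mxE mul_commutation_mx mxE.
Qed.

Lemma commutation_tensmx A B : T *m tensmx A B = tensmx B A *m T.
Proof.
apply/matrixP => k l; case: (mxtens_indexP k) => i j; case: (mxtens_indexP l) => a b.
by rewrite mul_commutation_mx mul_mx_commutation !tensmxE mulrC.
Qed.

Lemma commutation_eigenspaceP c (x : 'rV[R]_(n * n)) :
  reflect (forall i j, x 0 (ti (j, i)) = c * x 0 (ti (i, j)))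
    (x <= eigenspace T^T c)%MS.
Proof.
rewrite trmx_commutation; apply: (iffP eigenspaceP) => [xT i j|xT].
  by rewrite -mul_mx_commutation xT mxE.
apply/rowP => k; case: (mxtens_indexP k) => i j.
by rewrite mul_mx_commutation xT mxE.
Qed.

Lemma stable_commutation_eigenspace c A B :
  stablemx (eigenspace T^T c) (tensmx A B + tensmx B A).
Proof.
apply: comm_mx_stable_eigenspace; rewrite /comm_mx trmx_commutation.
by rewrite mulmxDl mulmxDr !commutation_tensmx addrC.
Qed.

(** Insert the commutation matrix after [x]: absorbed by [x] it gives the factor [c]; pushed through
    to [x^T] it swaps the Kronecker factors and gives [c] again. *)
Lemma quadratic_tensmxC c (x : 'rV[R]_(n * n)) A B : c != 0 ->
  (x <= eigenspace T^T c)%MS -> x *m tensmx A B *m x^T = x *m tensmx B A *m x^T.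
Proof.
move=> nzc; rewrite trmx_commutation => /eigenspaceP xT; apply: (scalerI nzc).
have Tx : T *m x^T = c *: x^T by rewrite -[T]trmx_commutation -trmx_mul xT linearZ.
transitivity (x *m T *m tensmx A B *m x^T); first by rewrite xT -!scalemxAl.
by rewrite -(mulmxA x T) commutation_tensmx -!mulmxA Tx -!scalemxAr.
Qed.

(** The coordinates at the pairs of [J] turn the vectors [f p] into an identity matrix, so they are
    independent. *)
Lemma card_le_rank (J : {set 'I_n * 'I_n}) (W : 'M[R]_(n * n))
    (f : 'I_n * 'I_n -> 'rV[R]_(n * n)) :
    (forall p, (f p <= W)%MS) ->
    {in J &, forall p q, f p 0 (ti q) = (p == q)%:R} ->
  (#|J| <= \rank W)%N.
Proof.
move=> fW fJ; pose F : 'M[R]_(#|J|, n * n) := \matrix_i f (enum_val i).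
suff rF : row_free F.
  rewrite -(eqP rF) mxrankS //; apply/row_subP => i; rewrite rowK; exact: fW.
apply/row_freeP; exists (colsub (fun i : 'I_#|J| => ti (enum_val i)) 1%:M).
rewrite mulmx_colsub mulmx1; apply/matrixP => i j.
by rewrite !mxE fJ ?enum_valP // (inj_eq enum_val_inj).
Qed.

(** The case d = 1 counts the pairs with i <= j, for symmetric vectors; d = 0 those with i < j, for
    skew-symmetric ones. *)
Lemma card_pair_lt (d : nat) : (d <= 1)%N ->
  #|[set p : 'I_n * 'I_n | (p.1 < p.2 + d)%N]| = (\sum_(j < n) (j + d))%N.
Proof.
move=> d1; rewrite -sum1dep_card.
rewrite (eq_bigl (fun p : 'I_n * 'I_n => true && (p.1 < p.2 + d)%N)) //.
rewrite -(pair_big_dep xpredT (fun i j : 'I_n => (i < j + d)%N) (fun _ _ => 1%N)) /=.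
rewrite (exchange_big_dep xpredT) //=; apply: eq_bigr => j _.
by rewrite sum1dep_card card_ord_ltn //; have := ltn_ord j; lia.
Qed.

(** Explicit independent vectors bound both ranks from below. The two spaces meet in 0, so the ranks
    add up to at most n^2, which is the sum of the lower bounds; both are therefore exact. *)
Lemma rank_symmetric_skew :
  \rank (symmetric_space R n) = (n * (n + 1) %/ 2)%N /\
  \rank (skew_space R n) = (n * (n - 1) %/ 2)%N.
Proof.
set s := \rank _; set t := \rank _.
have les : (\sum_(j < n) (j + 1) <= s)%N.
  rewrite -card_pair_lt //.
  (* The disjunction, unlike a sum of two indicators, gives the entry 1 and not 2 when the two
     indices of [p] coincide. *)
  pose f (p : 'I_n * 'I_n) : 'rV[R]_(n * n) :=
    \row_k (let q := mxtens_unindex k in (p == q) || (p == (q.2, q.1)))%:R.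
  apply: (@card_le_rank _ _ f) => [p|p q].
    apply/commutation_eigenspaceP => i j.
    by rewrite !mxE !mxtens_indexK /= mul1r orbC.
  case: p q => [a b] [i j]; rewrite !inE /= => leab leij.
  rewrite mxE mxtens_indexK /= !xpair_eqE.
  case: (boolP (_ && (b == j))) => //= nE; rewrite (_ : _ && _ = false) //.
  apply: contraNF nE => /andP[/eqP E1 /eqP E2]; subst.
  by apply/andP; split; apply/eqP/val_inj => /=; lia.
have let_ : (\sum_(j < n) (j + 0) <= t)%N.
  rewrite -card_pair_lt //.
  pose f (p : 'I_n * 'I_n) : 'rV[R]_(n * n) :=
    \row_k (let q := mxtens_unindex k in (p == q)%:R - (p == (q.2, q.1))%:R).
  apply: (@card_le_rank _ _ f) => [p|p q].
    apply/commutation_eigenspaceP => i j.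
    by rewrite !mxE !mxtens_indexK /= mulN1r opprB.
  case: p q => [a b] [i j]; rewrite !inE /= => leab leij.
  rewrite mxE mxtens_indexK /= [X in _ - X](_ : _ = 0) ?subr0 //.
  by case: eqP => // -[E1 E2]; subst; lia.
have lest : (s + t <= n * n)%N.
  rewrite -mxrank_sum_cap.
  have -> : (symmetric_space R n :&: skew_space R n)%MS = 0.
    apply/eqP/rowV0P => x; rewrite sub_capmx => /andP[].
    move=> /commutation_eigenspaceP xs /commutation_eigenspaceP xk.
    apply/rowP => k; case: (mxtens_indexP k) => i j; rewrite mxE.
    by have := xs i j; have := xk i j; lra.
  by rewrite mxrank0 addn0 rank_leq_row.
have sumE : (\sum_(j < n) (j + 0))%N = 'C(n, 2).
  by rewrite -bin2_sum big_mkord; apply: eq_bigr => j _; rewrite addn0.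
have sumE1 : (\sum_(j < n) (j + 1))%N = ('C(n, 2) + n)%N.
  by rewrite big_split /= sum_nat_const card_ord muln1 -bin2_sum big_mkord.
have C2 : ('C(n, 2) * 2 = n * (n - 1))%N.
  by rewrite bin2 subn1 -divn2 divnK // dvdn2 oddM; case: (n) => //= m; case: odd.
have n1 : (n * (n + 1) = n * (n - 1) + 2 * n)%N by case: (n) => // m; lia.
have nn : (n * n = n * (n - 1) + n)%N by case: (n) => // m; lia.
by split; lia.
Qed.

End Commutation.

(** * The sign change from skew-symmetric to symmetric vectors *)

Section PermutedTridiagonal.
Variables (R : realType) (n : nat) (A B : 'M[R]_n) (key : 'I_n -> nat).
Hypotheses (symA : A^T = A) (diagB : is_diag_mx B) (key_inj : injective key).
Hypothesis tridiagA : forall i j, A i j != 0 -> (key i <= (key j).+1)%N.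
Local Notation ti := (@mxtens_index n n).
Local Notation C := (tensmx A B + tensmx B A).

(** Antisymmetry in the two indices turns skew-symmetric vectors into symmetric ones. The value 0 at
    diagonal positions does no harm, as skew-symmetric vectors vanish there. *)
Definition order_sign (k : 'I_(n * n)) : R :=
  let p := mxtens_unindex k in (key p.1 < key p.2)%:R - (key p.2 < key p.1)%:R.
Local Notation D := (diag_mx (\row_k order_sign k)).

Lemma order_sign_index i j :
  order_sign (ti (i, j)) = (key i < key j)%:R - (key j < key i)%:R.
Proof. by rewrite /order_sign mxtens_indexK. Qed.

(* A step [key a <= key i + 1] cannot jump over a third key. *)
Lemma order_sign_neighbor i a j : A i a != 0 -> i != j -> a != j ->
  [/\ (key i < key j) = (key a < key j),
      (key j < key i) = (key j < key a) & (key i < key j) || (key j < key i)]%N.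
Proof.
move=> nzA; have nzA' : A a i != 0 by rewrite -symA mxE.
rewrite -!(inj_eq key_inj).
have := tridiagA nzA; have := tridiagA nzA'.
by move=> *; split; lia.
Qed.

Definition sign_compatible (M : 'M[R]_(n * n)) := forall i j a b,
  M (ti (i, j)) (ti (a, b)) != 0 -> i != j -> a != b ->
  order_sign (ti (i, j)) * order_sign (ti (a, b)) = 1.

(** A nonzero entry forces [j = b], as [B] is diagonal, and keys of [i] and [a] at distance at most
    1; both differ from [j], hence lie on the same side of it. *)
Lemma sign_compatible_tensl : sign_compatible (tensmx A B).
Proof.
move=> i j a b; rewrite tensmxE mulf_eq0 negb_or => /andP[nzA nzB] neij.
have <- : j = b.
  by apply/eqP; apply: contraNT nzB => ne; rewrite (is_diag_mxP diagB).
move=> neaj; rewrite !order_sign_index.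
have [-> ->] := order_sign_neighbor nzA neij neaj.
by case: ltngtP => //= _ _; rewrite ?subr0 ?sub0r ?mulrNN mulr1.
Qed.

Lemma sign_compatible_tensr : sign_compatible (tensmx B A).
Proof.
move=> i j a b; rewrite tensmxE => nz ij ab.
(* Transposing both positions flips both signs, which reduces the claim to [tensmx A B]. *)
rewrite -mulrNN !order_sign_index !opprB -!order_sign_index.
apply: sign_compatible_tensl.
- by rewrite tensmxE mulrC.
- by rewrite eq_sym.
- by rewrite eq_sym.
Qed.

Lemma sign_compatibleD M N :
  sign_compatible M -> sign_compatible N -> sign_compatible (M + N).
Proof.
move=> cM cN i j a b; rewrite mxE => nz.
have [M0|] := eqVneq (M (ti (i, j)) (ti (a, b))) 0.
  by apply: cN; move: nz; rewrite M0 add0r.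
exact: cM.
Qed.

Lemma sign_compatible1 : sign_compatible 1%:M.
Proof.
move=> i j a b; rewrite mxE (can_eq (@mxtens_indexK n n)).
have [[<- <-] _ ij _|_] := (i, j) =P (a, b); last by rewrite eqxx.
rewrite !order_sign_index; move: ij; rewrite -(inj_eq key_inj).
by case: ltngtP => //= _ _; rewrite ?subr0 ?sub0r ?mulrNN mulr1.
Qed.

Lemma skew_diag_eq0 r (X : 'M[R]_(r, n * n)) k i :
  (X <= skew_space R n)%MS -> X k (ti (i, i)) = 0.
Proof.
move=> /row_subP/(_ k)/commutation_eigenspaceP/(_ i i); rewrite !mxE; lra.
Qed.

(** In the expanded double sum, each term acquires a product of two signs, equal to 1 unless the
    term vanishes. For the identity matrix this says that [D] preserves inner products of
    skew-symmetric vectors. *)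
Lemma sign_congruence p q M (X : 'M[R]_(p, n * n)) (Y : 'M[R]_(q, n * n)) :
    sign_compatible M -> (X <= skew_space R n)%MS -> (Y <= skew_space R n)%MS ->
  X *m D *m M *m (Y *m D)^T = X *m M *m Y^T.
Proof.
move=> cM skX skY; rewrite trmx_mul tr_diag_mx !mulmxA -(mulmxA X) -(mulmxA X).
apply/matrixP => u v; rewrite !mxE; apply: eq_bigr => l _; rewrite !mxE.
rewrite !mulr_suml; apply: eq_bigr => k _.
rewrite mul_diag_mx mul_mx_diag !mxE.
case: (mxtens_indexP k) => i j; case: (mxtens_indexP l) => a b.
have [->|ij] := eqVneq i j; first by rewrite skew_diag_eq0 // !mul0r.
have [->|ab] := eqVneq a b; first by rewrite [Y _ _]skew_diag_eq0 // !mulr0.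
have [->|nzM] := eqVneq (M (ti (i, j)) (ti (a, b))) 0.
  by rewrite !(mulr0, mul0r).
rewrite -[RHS]mul1r -(cM _ _ _ _ nzM ij ab); ring.
Qed.

Lemma skew_sign_symmetric r (X : 'M[R]_(r, n * n)) :
  (X <= skew_space R n)%MS -> (X *m D <= symmetric_space R n)%MS.
Proof.
move=> skX; apply/row_subP => k; apply/commutation_eigenspaceP => i j.
have /commutation_eigenspaceP/(_ i j) : (row k X <= skew_space R n)%MS.
  by rewrite (submx_trans (row_sub _ _)).
rewrite mul_mx_diag !mxE !order_sign_index => ->; ring.
Qed.

Lemma tensmx_sum_sym : C^T = C.
Proof.
rewrite linearD /= !trmx_tens symA (_ : B^T = B) //; apply/matrixP => i j; rewrite mxE.
have [->//|ne] := eqVneq i j.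
by rewrite !(is_diag_mxP diagB) // eq_sym.
Qed.

Lemma tridiagonal_interlacing : interlacing A B.
Proof.
have [rsym rskew] := rank_symmetric_skew R n.
have [U [lam [UU Usym slam UC]]] :=
  sorted_diagonalization tensmx_sum_sym
    (stable_commutation_eigenspace 1 A B) rsym.
have [V [bet [VV Vskew sbet VC]]] :=
  sorted_diagonalization tensmx_sum_sym
    (stable_commutation_eigenspace (- 1) A B) rskew.
have cC : sign_compatible C.
  exact: sign_compatibleD sign_compatible_tensl sign_compatible_tensr.
exists lam, bet; split.
- by split=> // mu; rewrite tensmx_sum_sym (rank_eigenspace_cap mu UU Usym UC).
- by split=> // mu; rewrite tensmx_sum_sym (rank_eigenspace_cap mu VV Vskew VC).
have skV : (V <= skew_space R n)%MS by rewrite Vskew.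
(* [Q] holds the coordinates, in the symmetric eigenbasis [U], of the sign-changed skew
   eigenvectors; it is the isometry fed to Cauchy interlacing. *)
have /submxP[Q QU] : (V *m D <= U)%MS by rewrite Usym skew_sign_symmetric.
move=> i lti; apply: (@cauchy_interlacing _ _ _ Q lam bet) => //.
  have := sign_congruence sign_compatible1 skV skV.
  by rewrite !mulmx1 VV QU trmx_mul mulmxA -(mulmxA Q) UU mulmx1.
have := sign_congruence cC skV skV.
rewrite VC -(mulmxA _ V V^T) VV mulmx1 => <-.
by rewrite QU trmx_mul -(mulmxA Q U) UC !mulmxA -(mulmxA _ U) UU mulmx1.
Qed.

Lemma tridiagonal_weak_interlacing : weak_interlacing A B.
Proof.
rewrite /weak_interlacing; set Qsym := symmetric_quotients _.
set Qskew := skew_quotients _.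
move=> [q0 [w0 [nzw0 Tw0] _]].
have sub : (Qskew `<=` Qsym)%classic.
  move=> _ [w [nzw /skew_spaceP skw] <-].
  have norm : w^T *m D *m (w^T *m D)^T = w^T *m w.
    by have := sign_congruence sign_compatible1 skw skw; rewrite !mulmx1 [w^T^T]trmxK.
  exists (w^T *m D)^T; first split.
  - rewrite trmx_eq0 -mulmx_tr_eq0 norm -{2}[w]trmxK mulmx_tr_eq0.
    by rewrite trmx_eq0.
  - by apply/symmetric_spaceP; rewrite trmxK skew_sign_symmetric.
  rewrite /rayleigh [_^T^T]trmxK norm; congr (_ 0 0 / _).
  by rewrite (sign_congruence sign_compatible_tensl skw skw) trmxK.
have extrema c P
    (S := [set rayleigh (tensmx A B) u | u in [set u | u != 0 /\ P u]]%classic) :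
    c != 0 ->
    (forall u, (u^T <= eigenspace (commutation_mx R n)^T c)%MS <-> P u) ->
    (S !=set0)%classic -> (exists a, is_min S a) /\ (exists b, is_max S b).
  move=> nzc WP [_ [u [nzu Pu] _]].
  (* Half of [C] averages the two Kronecker orders, whose quadratic forms agree on eigenvectors of
     the commutation matrix. *)
  apply: (rayleigh_extrema (C := 2^-1 *: C) _ _ _ _ WP).
  - by rewrite linearZ /= tensmx_sum_sym.
  - by rewrite -scalemxAr scalemx_sub // stable_commutation_eigenspace.
  - apply: contraNneq nzu => W0; move/WP: Pu.
    by rewrite W0 submx0 trmx_eq0.
  move=> x xW; rewrite -scalemxAr -scalemxAl mulmxDr mulmxDl.
  rewrite (quadratic_tensmxC B A nzc xW).
  by apply/matrixP => i j; rewrite !mxE; field.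
have Qskew0 : (Qskew !=set0)%classic by exists (rayleigh (tensmx A B) w0), w0.
have Qsym0 : (Qsym !=set0)%classic by case: Qskew0 => q /sub; exists q.
have [[a1 [Qa1 lba1]] [b1 [Qb1 ubb1]]] :=
  extrema 1 _ (oner_neq0 _) (@symmetric_spaceP R n) Qsym0.
have nzN1 : -1 != 0 :> R by rewrite oppr_eq0 oner_neq0.
have [[a2 [Qa2 lba2]] [b2 [Qb2 ubb2]]] :=
  extrema (-1) _ nzN1 (@skew_spaceP R n) Qskew0.
split; [exists a1, a2 | exists b2, b1]; split=> //.
  exact/lba1/sub.
exact/ubb1/sub.
Qed.

End PermutedTridiagonal.

(** * Diagonal matrices perturbed along an antidiagonal *)

Theorem proposition8 (R : realType) (n : nat) (A B : 'M[R]_n)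
    (hA : is_diag_mx A) (hB : is_diag_mx B)
    (k : nat) (hk : (1 <= k <= n)%N) (alpha : nat -> R) :
  let At := A + \sum_(1 <= i < k./2.+1)
      alpha i *: (elem_mx R n i (k - i + 1) + (elem_mx R n i (k - i + 1))^T) in
  interlacing At B /\ weak_interlacing At B.
Proof.
move=> At.
(* Lists the (1-based) indices as 1, k, 2, k - 1, ..., k + 1, k + 2, ...: in this
   order [At] is tridiagonal. *)
pose key (i : 'I_n) : nat :=
  if (k <= i)%N then i.*2 else if (i.*2 < k)%N then i.*2 else ((k - i.+1).*2.+1)%N.
have key_inj : injective key.
  move=> i j; rewrite /key => E; apply/val_inj => /=; move: E.
  by repeat case: ifP; lia.
have symAt : At^T = At.
  rewrite /At linearD linear_sum /=; congr (_ + _).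
    apply/matrixP => i j; rewrite mxE; have [->//|ne] := eqVneq i j.
    by rewrite !(is_diag_mxP hA) // eq_sym.
  by apply: eq_bigr => i _; rewrite linearZ /= linearD /= trmxK addrC.
have tridiagAt i j : At i j != 0 -> (key i <= (key j).+1)%N.
  have [->|ij] := eqVneq i j; first by rewrite leqnSn.
  rewrite mxE (is_diag_mxP hA) // add0r summxE.
  (* The added entries sit where the 0-based indices satisfy i + j + 1 = k. There the smaller index,
     say i, has key 2i and the larger one 2i + 1. *)
  have [E _|ne] := eqVneq (i + j).+1 k.
    by rewrite /key; repeat case: ifP; lia.
  rewrite big_nat big1 ?eqxx // => m /andP[m1 mk].
  have noE p q : (p + q).+1 != k -> (p.+1 == m) && (q.+1 == k - m + 1)%N = false.
    by move=> nepq; apply/negbTE/negP => /andP[/eqP ? /eqP ?]; lia.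
  by rewrite !mxE !noE ?addr0 ?mulr0 // addnC.
split; first exact: tridiagonal_interlacing tridiagAt.
exact: tridiagonal_weak_interlacing tridiagAt.
Qed.
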